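(* Let $\psi:\mathcal M\to\mathcal W_\psi$ be expressible as a composition of $k$ primitives $\theta_1,\dots,\theta_k$ in the sense described in the context (forward evaluation). Fix $P\in\mathcal M$ and let $h_1,\dots,h_k$ be the values computed by the forward evaluation with input $P$. Suppose that, for every $j\in\{1,\dots,k\}$, $\theta_j$ is totally pathwise differentiable at $(P,h_{\mathrm{pa}(j)})$. Then $\psi$ is pathwise differentiable at $P$ and, for every $f_k\in\mathcal W_\psi$, the backpropagation algorithm described in the context, run with input $f_k$ and $h_1,\dots,h_k$, returns $f_0=\dot\psi_P^*(f_k)$, the evaluation at $f_k$ of the efficient influence operator of $\psi$ at $P$.
   Context: All Hilbert spaces are real. $\mathcal M$ is a set of probability distributions (the model) on a measurable space $\mathcal Z$, and $\mathcal W_\psi$ is a Hilbert space. **Tangent sets and spaces.** For $P\in\mathcal M$ and $s\in L^2(P)$, $\mathscr P(P,\mathcal M,s)$ is the collection of submodels $\{P_\epsilon:\epsilon\in[0,1]\}\subseteq\mathcal M$ with $P_{\epsilon=0}=P$ that are quadratic mean differentiable with score $s$ at $\epsilon=0$, i.e. $\int(\sqrt{dP_\epsilon}-\sqrt{dP}-\tfrac{\epsilon}{2}s\sqrt{dP})^2=o(\epsilon^2)$ as $\epsilon\to0$. The tangent set is $\check{\mathcal M}_P=\{s\in L^2(P):\mathscr P(P,\mathcal M,s)\neq\emptyset\}$ and the tangent space $\dot{\mathcal M}_P$ is the $L^2(P)$-closure of its linear span. For a subset $\mathcal U$ of a Hilbert space $\mathcal T$, $u\in\mathcal U$, $t\in\mathcal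 T$, $\mathscr P(u,\mathcal U,t)$ is the set of paths $\{u_\epsilon:\epsilon\in[0,1]\}\subseteq\mathcal U$ with $\|u_\epsilon-u-\epsilon t\|_{\mathcal T}=o(\epsilon)$ as $\epsilon\to0$; $\check{\mathcal U}_u=\{t\in\mathcal T:\mathscr P(u,\mathcal U,t)\ne\emptyset\}$ and $\dot{\mathcal U}_u$ is the $\mathcal T$-closure of its linear span. **Total pathwise differentiability.** A map $\theta:\mathcal M\times\mathcal U\to\mathcal V$, with $\mathcal U\subseteq\mathcal T$ and $\mathcal V\subseteq\mathcal W$ for ambient Hilbert spaces $\mathcal T,\mathcal W$, is totally pathwise differentiable at $(P,u)$ if there is a continuous linear $\dot\theta_{P,u}:\dot{\mathcal M}_P\oplus\dot{\mathcal U}_u\to\mathcal W$ such that for all $s\in\check{\mathcal M}_P$, $t\in\check{\mathcal U}_u$, $\{P_\epsilon\}\in\mathscr P(P,\mathcal M,s)$, $\{u_\epsilon\}\in\mathscr P(u,\mathcal U,t)$, $\|\theta(P_\epsilon,u_\epsilon)-\theta(P,u)-\epsilon\,\dot\theta_{P,u}(s,t)\|_{\mathcal W}=o(\epsilon)$. The (unique) differential operator $\dot\theta_{P,u}$ has Hermitian adjoint $\dot\theta_{P,u}^*:\mathcal W\to\dot{\mathcal M}_P\oplus\dot{\mathcal U}_u$. **Pathwise differentiability.** $\nu:\mathcal M\to\mathcal W$ is pathwise differentiable at $P$ if there is a continuous linear $\dot\nu_P:\dot{\mathcal M}_P\to\mathcal W$ with $\|\nu(P_\epsilon)-\nu(P)-\epsilon\,\dot\nu_P(s)\|_{\mathcal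 W}=o(\epsilon)$ for all $s\in\check{\mathcal M}_P$ and $\{P_\epsilon\}\in\mathscr P(P,\mathcal M,s)$. Its efficient influence operator at $P$ is the Hermitian adjoint $\dot\nu_P^*:\mathcal W\to\dot{\mathcal M}_P$. **Forward evaluation.** For each $j\in[k]:=\{1,\dots,k\}$ there are: an index set $\mathrm{pa}(j)\subseteq\{1,\dots,j-1\}$; a set $\mathcal V_j$ contained in a Hilbert space $\mathcal W_j$, with $\mathcal W_k=\mathcal W_\psi$; a set $\mathcal U_j\supseteq\prod_{i\in\mathrm{pa}(j)}\mathcal V_i$ contained in the direct sum Hilbert space $\bigoplus_{i\in\mathrm{pa}(j)}\mathcal W_i$ ($\mathcal U_j=\{0\}$, in the trivial Hilbert space $\{0\}$, if $\mathrm{pa}(j)=\emptyset$); and a primitive $\theta_j:\mathcal M\times\mathcal U_j\to\mathcal V_j$, with ambient spaces $\bigoplus_{i\in\mathrm{pa}(j)}\mathcal W_i$ and $\mathcal W_j$. For a tuple $(a_i)$ and index set $\mathcal S$, $a_{\mathcal S}:=(a_i:i\in\mathcal S)$, with $a_\emptyset:=0$. Given input $P'\in\mathcal M$, the forward evaluation computes successively $h_j=\theta_j(P',h_{\mathrm{pa}(j)})$ for $j=1,\dots,k$ and returns $h_k$. ''$\psi$ is expressible as a composition of the primitives'' means that for every $P'\in\mathcal M$ the forward evaluation with input $P'$ returns $\psi(P')$. **Backpropagation algorithm.** Input: $f_k\in\mathcal W_\psi$ and the values $h_1,\dots,h_k$ of the forward evaluation at $P$. Initialize $f_0,f_1,\dots,f_{k-1}$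 as the zero elements of $L^2(P),\mathcal W_1,\dots,\mathcal W_{k-1}$. For $j=k,k-1,\dots,1$ in this order, replace $(f_0,f_{\mathrm{pa}(j)})$ by $(f_0,f_{\mathrm{pa}(j)})+\dot\theta_{j,P,h_{\mathrm{pa}(j)}}^*(f_j)$ (only $f_0$ is updated if $\mathrm{pa}(j)=\emptyset$). Return $f_0$. Here $\dot\theta^*_{j,P,u}$ is the adjoint of the differential operator of $\theta_j$ at $(P,u)$. *)

(* Defs.v *)
From HB Require Import structures.
From mathcomp Require Import all_boot all_order all_algebra.
From mathcomp Require Import all_classical all_reals all_analysis.

Set Implicit Arguments.
Unset Strict Implicit.
Unset Printing Implicit Defensive.
Import Order.TTheory GRing.Theory Num.Theory.
Import numFieldNormedType.Exports.
Local Open Scope classical_set_scope.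
Local Open Scope ring_scope.

(** * Hilbert spaces

   The inner product is only required to be positive semi-definite, so that
   [L^2(P)] can be handled through square-integrable representatives (equality
   in [L^2(P)] being equality [P]-a.e.). A [hilbertType] is a Banach space of
   the library whose norm comes from an inner product, hence a genuine real
   Hilbert space. *)
HB.mixin Record isSemiInner (R : realType) V of GRing.Lmodule R V := {
  inner : V -> V -> R ;
  innerC : forall x y, inner x y = inner y x ;
  innerDl : forall x y z, inner (x + y) z = inner x z + inner y z ;
  innerZl : forall a x z, inner (a *: x) z = a * inner x z ;
  inner_ge0 : forall x, 0 <= inner x x }.

#[short(type="semiInnerType")]
HB.structure Definition SemiInner (R : realType) :=
  {V of isSemiInner R V & GRing.Lmodule R V}.

Definition hnorm (R : realType) (V : semiInnerType R) (x : V) : R :=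
  Num.sqrt (inner x x).

HB.mixin Record hasInnerNorm (R : realType) V
    of CompleteNormedModule R V & SemiInner R V := {
  norm_inner : forall x : V, `|x| = Num.sqrt (inner x x) }.

#[short(type="hilbertType")]
HB.structure Definition Hilbert (R : realType) :=
  {V of hasInnerNorm R V & CompleteNormedModule R V & SemiInner R V}.

(** ** Direct sums *)

Definition dsum (R : realType) (I : finType) (W : I -> semiInnerType R) : Type :=
  forall i, W i.

Section dsum_instances.
Context (R : realType) (I : finType) (W : I -> semiInnerType R).
Implicit Types x y z : dsum W.

HB.instance Definition _ := gen_eqMixin (dsum W).
HB.instance Definition _ := gen_choiceMixin (dsum W).

Let add x y : dsum W := fun i => x i + y i.
Let opp x : dsum W := fun i => - x i.
Let zero : dsum W := fun=> 0.
Let scale (a : R) x : dsum W := fun i => a *: x i.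

Let addA : associative add.
Proof. by move=> x y z; apply/functional_extensionality_dep => i; exact: addrA. Qed.
Let addC : commutative add.
Proof. by move=> x y; apply/functional_extensionality_dep => i; exact: addrC. Qed.
Let add0 : left_id zero add.
Proof. by move=> x; apply/functional_extensionality_dep => i; exact: add0r. Qed.
Let addN : left_inverse zero opp add.
Proof. by move=> x; apply/functional_extensionality_dep => i; exact: addNr. Qed.

HB.instance Definition _ := GRing.isZmodule.Build (dsum W) addA addC add0 addN.

Let scaleA a b x : scale a (scale b x) = scale (a * b) x.
Proof. by apply/functional_extensionality_dep => i; exact: scalerA. Qed.
Let scale1 : left_id 1 scale.
Proof. by move=> x; apply/functional_extensionality_dep => i; exact: scale1r. Qed.
Let scaleDr : right_distributive scale +%R.
Proof. by move=> a x y; apply/functional_extensionality_dep => i; exact: scalerDr. Qed.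
Let scaleDl x : {morph scale^~ x : a b / a + b}.
Proof. by move=> a b; apply/functional_extensionality_dep => i; exact: scalerDl. Qed.

HB.instance Definition _ :=
  GRing.Zmodule_isLmodule.Build R (dsum W) scaleA scale1 scaleDr scaleDl.

Let dinner x y : R := \sum_i inner (x i) (y i).

Let dinnerC x y : dinner x y = dinner y x.
Proof. by apply: eq_bigr => i _; exact: innerC. Qed.
Let dinnerDl x y z : dinner (x + y) z = dinner x z + dinner y z.
Proof. by rewrite -big_split; apply: eq_bigr => i _; exact: innerDl. Qed.
Let dinnerZl a x z : dinner (a *: x) z = a * dinner x z.
Proof. by rewrite mulr_sumr; apply: eq_bigr => i _; exact: innerZl. Qed.
Let dinner_ge0 x : 0 <= dinner x x.
Proof. by apply: sumr_ge0 => i _; exact: inner_ge0. Qed.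

HB.instance Definition _ :=
  isSemiInner.Build R (dsum W) dinnerC dinnerDl dinnerZl dinner_ge0.

End dsum_instances.

(** [E * F] stands for the orthogonal direct sum of [E] and [F]: its norm is
    [hnorm], not the sup norm that the library puts on products. *)
Section prod_instance.
Context (R : realType) (E F : semiInnerType R).
Implicit Types x y z : E * F.

Let pinner x y : R := inner x.1 y.1 + inner x.2 y.2.

Let pinnerC x y : pinner x y = pinner y x.
Proof. by rewrite /pinner innerC (innerC x.2). Qed.
Let pinnerDl x y z : pinner (x + y) z = pinner x z + pinner y z.
Proof. by rewrite /pinner !innerDl addrACA. Qed.
Let pinnerZl a x z : pinner (a *: x) z = a * pinner x z.
Proof. by rewrite /pinner !innerZl mulrDr. Qed.
Let pinner_ge0 x : 0 <= pinner x x.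
Proof. by rewrite addr_ge0// inner_ge0. Qed.

HB.instance Definition _ :=
  isSemiInner.Build R (E * F)%type pinnerC pinnerDl pinnerZl pinner_ge0.

End prod_instance.

(** ** The space [L^2(mu)] *)

Notation L2 mu := (LfunType mu (lee1n 2)).

Section L2_instance.
Context d (Z : measurableType d) (R : realType).
Variable mu : {measure set Z -> \bar R}.
Implicit Types f g h : L2 mu.

Let linner f g : R := \int[mu]_z (f z * g z).

Let intM f g : mu.-integrable [set: Z] (EFin \o (fun z => f z * g z)).
Proof.
by apply/Lfun1_integrable; apply: Lfun2_mul_Lfun1; exact: LfunP.
Qed.

Let linnerC f g : linner f g = linner g f.
Proof. by apply: eq_Rintegral => z _; exact: mulrC. Qed.
Let linnerDl f g h : linner (f + g) h = linner f h + linner g h.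
Proof.
rewrite /linner -RintegralD//; try exact: intM.
by apply: eq_Rintegral => z _; rewrite -mulrDl.
Qed.
Let linnerZl a f h : linner (a *: f) h = a * linner f h.
Proof.
rewrite /linner -RintegralZl//; try exact: intM.
by apply: eq_Rintegral => z _; rewrite mulrA.
Qed.
Let linner_ge0 f : 0 <= linner f f.
Proof. by apply: Rintegral_ge0 => z _; rewrite -expr2 sqr_ge0. Qed.

HB.instance Definition _ :=
  isSemiInner.Build R (L2 mu) linnerC linnerDl linnerZl linner_ge0.

End L2_instance.

(** ** Subspaces and operators defined on subspaces *)

Section operators.
Context (R : realType) (E F : semiInnerType R).

Definition lspan (A : set E) : set E :=
  [set x | exists m (a : 'I_m -> R) (v : 'I_m -> E),
    (forall i, A (v i)) /\ x = \sum_i a i *: v i].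

Definition hclosure (A : set E) : set E :=
  [set x | forall r, 0 < r -> exists2 y, A y & hnorm (x - y) < r].

(** Operators are total functions, considered on a linear subspace [A] only. *)
Definition linear_on (A : set E) (D : E -> F) : Prop :=
  forall a x y, A x -> A y -> D (a *: x + y) = a *: D x + D y.

Definition continuous_on (A : set E) (D : E -> F) : Prop :=
  forall x, A x -> forall r, 0 < r -> exists2 eta, 0 < eta &
    forall y, A y -> hnorm (y - x) < eta -> hnorm (D y - D x) < r.

(** The Hermitian adjoint [F -> A] of [D : A -> F], for [A] a closed linear
    subspace of a Hilbert space and [D] continuous linear on [A]: [adjoint A D w]
    is then the element of [A] that represents [y |-> inner (D y) w], which
    exists by the Riesz theorem and is unique up to elements of norm 0. *)
Definition adjoint (A : set E) (D : E -> F) (w : F) : E :=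
  xget 0 [set x | A x /\ forall y, A y -> inner (D y) w = inner y x].

End operators.

(** * Paths and tangent spaces *)

Section psum.
Context (R : realType) d (Z : measurableType d).
Implicit Types P Q : probability Z R.

Definition psum P Q : set Z -> \bar R := measure_add P Q.

HB.instance Definition _ P Q := Measure.on (psum P Q).

Let psum_fin P Q : fin_num_fun (psum P Q).
Proof.
by move=> A mA; rewrite /psum measure_addE fin_numD !fin_num_measure.
Qed.

HB.instance Definition _ P Q :=
  Measure_isFinite.Build _ _ _ (psum P Q) (@psum_fin P Q).

End psum.

Section tangent.
Context (R : realType) d (Z : measurableType d).
Implicit Types (P Q : probability Z R) (M : set (probability Z R)).

Local Open Scope charge_scope.

(** Density of [N], one of [P] and [Q], with respect to [P + Q]. *)
Definition dens P Q (N : probability Z R) (z : Z) : R :=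
  fine (('d (charge_of_finite_measure N) '/d (psum P Q)) z).

(** The integral of [(sqrt dQ - sqrt dP - eps/2 * s * sqrt dP)^2]. It does not
    depend on the measure dominating [P] and [Q], here taken to be [P + Q]. *)
Definition qmd_remainder P Q (s : Z -> R) (eps : R) : \bar R :=
  (\int[psum P Q]_z
    ((Num.sqrt (dens P Q Q z) - Num.sqrt (dens P Q P z)
      - eps / 2 * s z * Num.sqrt (dens P Q P z)) ^+ 2)%:E)%E.

(** [model_path M s] is the collection of submodels with score [s] at [P];
    paths are functions on [R], of which only the restriction to [0, 1]
    matters. *)
Definition model_path M P (s : L2 P) : set (R -> probability Z R) :=
  [set Pe | [/\ forall e, 0 <= e <= 1 -> M (Pe e), Pe 0 = P &
    ((e ^- 2)%:E * qmd_remainder P (Pe e) s e)%E @[e --> 0^'+] --> 0%E]].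

Definition model_tangent_set M P : set (L2 P) :=
  [set s | exists Pe, model_path M s Pe].

Definition model_tangent_space M P : set (L2 P) :=
  hclosure (lspan (model_tangent_set M (P := P))).

Definition set_path (T : semiInnerType R) (U : set T) (u t : T) : set (R -> T) :=
  [set ue | (forall e, 0 <= e <= 1 -> U (ue e)) /\
    (fun e : R => hnorm (ue e - u - e *: t)) =o_ (0^'+) (fun e : R => e)].

Definition set_tangent_set (T : semiInnerType R) (U : set T) (u : T) : set T :=
  [set t | exists ue, set_path U u t ue].

Definition set_tangent_space (T : semiInnerType R) (U : set T) (u : T) : set T :=
  hclosure (lspan (set_tangent_set U u)).

End tangent.

Arguments model_tangent_set {R d Z} M P.
Arguments model_tangent_space {R d Z} M P.

(** * Differentiability along paths *)

Section differentiability.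
Context (R : realType) d (Z : measurableType d).
Variable M : set (probability Z R).

Section total.
Context (T : semiInnerType R) (W : hilbertType R).
Variables (U : set T) (theta : probability Z R -> T -> W).
Variables (P : probability Z R) (u : T).

Definition total_tangent_space : set (L2 P * T) :=
  model_tangent_space M P `*` set_tangent_space U u.

Definition is_total_differential (D : L2 P * T -> W) : Prop :=
  [/\ linear_on total_tangent_space D,
      continuous_on total_tangent_space D &
    forall s t Pe ue, model_path M s Pe -> set_path U u t ue ->
      (fun e : R => hnorm (theta (Pe e) (ue e) - theta P u - e *: D (s, t)))
        =o_ (0^'+) (fun e : R => e)].

Definition totally_pathwise_differentiable : Prop :=
  exists D, is_total_differential D.

(** Only its restriction to the tangent space is unique. *)
Definition total_differential : L2 P * T -> W :=
  xget (fun=> 0) [set D | is_total_differential D].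

Definition total_differential_adjoint : W -> L2 P * T :=
  adjoint total_tangent_space total_differential.

End total.

Section single.
Context (W : hilbertType R).
Variables (nu : probability Z R -> W) (P : probability Z R).

Definition is_differential (D : L2 P -> W) : Prop :=
  [/\ linear_on (model_tangent_space M P) D,
      continuous_on (model_tangent_space M P) D &
    forall s Pe, model_path M s Pe ->
      (fun e : R => hnorm (nu (Pe e) - nu P - e *: D s))
        =o_ (0^'+) (fun e : R => e)].

Definition pathwise_differentiable : Prop := exists D, is_differential D.

Definition differential : L2 P -> W :=
  xget (fun=> 0) [set D | is_differential D].

Definition efficient_influence_operator : W -> L2 P :=
  adjoint (model_tangent_space M P) differential.

End single.

End differentiability.

(** * Forward evaluation and backpropagation

   There are [n.+1] primitives, indexed by ['I_n.+1]; the index of the last one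
   is [ord_max]. *)

Section algorithms.
Context (R : realType) (n : nat) (pa : 'I_n.+1 -> {set 'I_n.+1}).
Context (W : 'I_n.+1 -> hilbertType R).

Definition parent (j : 'I_n.+1) : finType := {i : 'I_n.+1 | i \in pa j}.

(** The direct sum of the [W i] for [i \in pa j]; it is a singleton when [pa j]
    is empty. *)
Definition Wpa (j : 'I_n.+1) : semiInnerType R :=
  dsum (fun i : parent j => W (val i)).

Definition restrict_pa (a : forall i, W i) (j : 'I_n.+1) : Wpa j :=
  fun i => a (val i).
Arguments restrict_pa : clear implicits.

Definition extend_pa (j : 'I_n.+1) (g : Wpa j) (i : 'I_n.+1) : W i :=
  match @idP (i \in pa j) with
  | ReflectT ij => g (exist _ i ij)
  | ReflectF _ => 0
  end.

Section forward.
Context d (Z : measurableType d).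
Variable theta : forall j, probability Z R -> Wpa j -> W j.

Definition forward_step (Q : probability Z R) (h : forall i, W i)
    (j : 'I_n.+1) : forall i, W i :=
  dfwith h j (theta Q (restrict_pa h j)).

Definition forward (Q : probability Z R) : forall i, W i :=
  foldl (forward_step Q) (fun=> 0) (enum 'I_n.+1).

End forward.

Section backward.
Context (E : semiInnerType R).
Variable adj : forall j, W j -> E * Wpa j.

Definition backprop_step (f : E * (forall i, W i)) (j : 'I_n.+1) :
    E * (forall i, W i) :=
  let g := adj (f.2 j) in (f.1 + g.1, fun i => f.2 i + extend_pa g.2 i).

Definition backprop (fk : W ord_max) : E :=
  let z : forall i, W i := fun=> 0 in
  (foldl backprop_step (0, dfwith z ord_max fk) (rev (enum 'I_n.+1))).1.

End backward.

End algorithms.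

Arguments restrict_pa {R n pa W} a j.

(* Main.v *)
Require Import Defs.
From mathcomp Require Import all_boot all_order all_algebra.
From mathcomp Require Import all_classical all_reals all_analysis.
From mathcomp Require Import measurable_realfun.
From mathcomp Require Import ring lra zify.

Set Implicit Arguments.
Unset Strict Implicit.
Unset Printing Implicit Defensive.
Import Order.TTheory GRing.Theory Num.Theory.
Import numFieldNormedType.Exports.
Local Open Scope classical_set_scope.
Local Open Scope ring_scope.

(** The derivative of the forward evaluation at [P] in the direction [s] is the
    forward evaluation of the total differentials, [dforward s]: a path with
    score [s] is mapped by the first nodes to a path in [U j] with direction the
    derivatives of the parents of [j], so that the chain rule applies at node
    [j]. It remains linear and bounded on the tangent space, which it maps into
    the tangent spaces of the [U j]. Transposing this recursion node by node
    shows that backpropagation returns an element [f0] of the tangent space with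
    [<dforward s, fk> = <s, f0>] for all [s], which characterizes the adjoint up
    to elements of norm 0. Adjoints exist by the Riesz representation theorem,
    which relies on the completeness of [L^2(P)]. *)

(** * Semi-inner product spaces *)

Section semi_inner_theory.
Context {R : realType} {E : semiInnerType R}.
Implicit Types (x y z : E) (a r : R).

Lemma inner0l x : inner 0 x = 0.
Proof. by rewrite -(scale0r 0) innerZl mul0r. Qed.

Lemma innerDr x y z : inner x (y + z) = inner x y + inner x z.
Proof. by rewrite innerC innerDl !(innerC x). Qed.

Lemma innerZr a x y : inner x (a *: y) = a * inner x y.
Proof. by rewrite innerC innerZl (innerC x). Qed.

Lemma innerNr x y : inner x (- y) = - inner x y.
Proof. by rewrite -scaleN1r innerZr mulN1r. Qed.

Lemma innerNl x y : inner (- x) y = - inner x y.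
Proof. by rewrite innerC innerNr innerC. Qed.

Lemma innerBr x y z : inner x (y - z) = inner x y - inner x z.
Proof. by rewrite innerDr innerNr. Qed.

Lemma hnorm_ge0 x : 0 <= hnorm x. Proof. exact: sqrtr_ge0. Qed.

Lemma hnorm_sqr x : hnorm x ^+ 2 = inner x x.
Proof. by rewrite sqr_sqrtr// inner_ge0. Qed.

Lemma hnorm_le x r : 0 <= r -> (hnorm x <= r) = (inner x x <= r ^+ 2).
Proof. by move=> r0; rewrite -hnorm_sqr ler_sqr// nnegrE ?hnorm_ge0. Qed.

Lemma hnorm_lt x r : 0 <= r -> (hnorm x < r) = (inner x x < r ^+ 2).
Proof. by move=> r0; rewrite -hnorm_sqr ltr_sqr// nnegrE ?hnorm_ge0. Qed.

Lemma hnormZ a x : hnorm (a *: x) = `|a| * hnorm x.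
Proof.
by rewrite /hnorm innerZl innerZr mulrA -expr2 sqrtrM ?sqr_ge0// sqrtr_sqr.
Qed.

Lemma hnormN x : hnorm (- x) = hnorm x.
Proof. by rewrite -scaleN1r hnormZ normrN1 mul1r. Qed.

Lemma hnormC x y : hnorm (x - y) = hnorm (y - x).
Proof. by rewrite -hnormN opprB. Qed.

Lemma hnorm0 : hnorm (0 : E) = 0.
Proof. by rewrite /hnorm inner0l sqrtr0. Qed.

(** The value [t = - g / (q + 1)] gives the bound. The denominator is [q + 1] and not [q] because
    [q] will be the squared norm of a possibly null vector. *)
Lemma quadratic_lower_bound (q g b : R) : 0 <= q ->
  (forall t : R, - b <= t ^+ 2 * q + 2 * t * g) -> g ^+ 2 <= b * (q + 1).
Proof.
move=> q0 /(_ (- g / (q + 1))) h; have q1 : 0 < q + 1 by lra.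
have q1' : q + 1 != 0 by rewrite gt_eqF.
rewrite -ler_pdivrMr// -subr_ge0.
have -> : b - g ^+ 2 / (q + 1) =
    (- g / (q + 1)) ^+ 2 * q + 2 * (- g / (q + 1)) * g + b + (g / (q + 1)) ^+ 2.
  by field.
by rewrite addr_ge0 ?sqr_ge0// -lerBlDr sub0r.
Qed.

Lemma cauchy_schwarz x y : `|inner x y| <= hnorm x * hnorm y.
Proof.
have xy t : 0 <= inner x x + t ^+ 2 * inner y y + 2 * t * inner x y.
  have := inner_ge0 (x + t *: y).
  by rewrite !innerDl !innerDr !innerZl !innerZr (innerC y x); congr (_ <= _); ring.
suff : inner x y ^+ 2 <= inner x x * inner y y.
  rewrite -!hnorm_sqr -exprMn -(real_normK (num_real (inner x y))) ler_sqr//.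
  by rewrite nnegrE mulr_ge0 ?hnorm_ge0.
have [y0|y0] := eqVneq (inner y y) 0; last first.
  have ypos : 0 < inner y y by rewrite lt_neqAle eq_sym y0 inner_ge0.
  have := mulr_ge0 (xy (- inner x y / inner y y)) (ltW ypos).
  rewrite -[inner x y ^+ 2 <= _]subr_ge0; congr (_ <= _); field; exact: y0.
rewrite y0 mulr0 leNgt; apply/negP => h.
have g0 : inner x y != 0 by rewrite -(sqrf_eq0) gt_eqF.
(* For [y] of norm 0 the quadratic is affine in [t], and this [t] gives it the value -1. *)
have := xy (- (inner x x + 1) / (2 * inner x y)).
rewrite y0 mulr0 addr0 [X in 0 <= X](_ : _ = - 1) ?oppr_ge0 ?ler10//.
by field.
Qed.

Lemma ler_hnormD x y : hnorm (x + y) <= hnorm x + hnorm y.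
Proof.
rewrite hnorm_le ?addr_ge0 ?hnorm_ge0// innerDl !innerDr (innerC y x).
rewrite sqrrD !hnorm_sqr; have := cauchy_schwarz x y.
by rewrite ler_norml => /andP[_]; lra.
Qed.

Lemma ler_hnormB x y : hnorm (x - y) <= hnorm x + hnorm y.
Proof. by rewrite (le_trans (ler_hnormD _ _))// hnormN. Qed.

Lemma hnorm_triangle x y z : hnorm (x - z) <= hnorm (x - y) + hnorm (y - z).
Proof. by rewrite -[x - z](subrKA y) ler_hnormD. Qed.

(** * Subspaces, spans, closures and completeness for the seminorm *)

Definition linear_subspace (A : set E) : Prop :=
  A 0 /\ forall a x y, A x -> A y -> A (a *: x + y).

(** Formulated with [hnorm] because a [semiInnerType] carries no topology; limits are unique only up
    to elements of norm 0. *)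
Definition hcauchy (u : nat -> E) : Prop :=
  forall r, 0 < r ->
    exists N, forall m n, (N <= m)%N -> (N <= n)%N -> hnorm (u m - u n) < r.

Definition hcvg (u : nat -> E) x : Prop :=
  forall r, 0 < r -> \forall n \near \oo, hnorm (u n - x) < r.

Definition hcomplete (A : set E) : Prop :=
  forall u, (forall n, A (u n)) -> hcauchy u -> exists2 x, A x & hcvg u x.

Lemma subspaceB (A : set E) x y : linear_subspace A -> A x -> A y -> A (x - y).
Proof. by move=> [_ SA] Ax Ay; rewrite addrC -scaleN1r; exact: SA. Qed.

Lemma subspaceZ (A : set E) a x : linear_subspace A -> A x -> A (a *: x).
Proof. by move=> [A0 SA] Ax; rewrite -[_ *: _]addr0; exact: SA. Qed.

Lemma subset_lspan (S : set E) : S `<=` lspan S.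
Proof.
move=> x Sx; exists 1%N, (fun=> 1), (fun=> x); split => //.
by rewrite big_ord1 scale1r.
Qed.

Lemma lspan_subspace (S : set E) : linear_subspace (lspan S).
Proof.
split; first by exists 0%N, (fun=> 0), (fun=> 0); split; [case|rewrite big_ord0].
move=> a _ _ [m [b [v [Sv ->]]]] [k [c [w [Sw ->]]]].
exists (m + k)%N,
  (fun i : 'I_(m + k) =>
    match fintype.split i with inl j => a * b j | inr l => c l end),
  (fun i : 'I_(m + k) =>
    match fintype.split i with inl j => v j | inr l => w l end).
split=> [i|]; first by case: fintype.split.
rewrite big_split_ord scaler_sumr; congr (_ + _); apply: eq_bigr => i _.
- by rewrite (unsplitK (inl i)) scalerA.
- by rewrite (unsplitK (inr i)).
Qed.

Lemma sum_subspace (A : set E) m (a : 'I_m -> R) (v : 'I_m -> E) :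
  linear_subspace A -> (forall i, A (v i)) -> A (\sum_i a i *: v i).
Proof.
move=> [A0 SA] Av; elim/big_rec: _ => // i x _ Ax; exact: SA.
Qed.

Lemma lspan_min (S A : set E) : linear_subspace A -> S `<=` A -> lspan S `<=` A.
Proof.
by move=> sA SA _ [m [a [v [Sv ->]]]]; apply: sum_subspace => // i; exact: SA.
Qed.

Lemma subset_hclosure (A : set E) : A `<=` hclosure A.
Proof. by move=> x Ax r r0; exists x => //; rewrite subrr hnorm0. Qed.

Lemma hclosure_subspace (A : set E) : linear_subspace A -> linear_subspace (hclosure A).
Proof.
move=> sA; split; first exact/subset_hclosure/sA.1.
move=> a x y Ax Ay r r0.
have a1 : 0 < `|a| + 1 by rewrite ltr_wpDl.
have [x' Ax' xx'] := Ax (r / 2 / (`|a| + 1)) (divr_gt0 (divr_gt0 r0 (ltr0Sn _ 1)) a1).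
have [y' Ay' yy'] := Ay (r / 2) (divr_gt0 r0 (ltr0Sn _ 1)).
exists (a *: x' + y'); first exact: sA.2.
rewrite opprD addrACA -scalerBr (le_lt_trans (ler_hnormD _ _))// hnormZ.
rewrite [ltRHS]splitr ler_ltD//; move: xx'; rewrite ltr_pdivlMr// => xx'.
have := hnorm_ge0 (x - x'); nra.
Qed.

Lemma hclosure_complete (A : set E) :
  hcomplete [set: E] -> hcomplete (hclosure A).
Proof.
move=> cE u Au /(cE _ (fun=> I))[x _ ux]; exists x => // r r0.
have [n _ /(_ n (leqnn n)) unx] := ux (r / 2) (divr_gt0 r0 (ltr0Sn _ 1)).
have [y Ay uny] := Au n (r / 2) (divr_gt0 r0 (ltr0Sn _ 1)).
exists y => //; rewrite (le_lt_trans (hnorm_triangle _ (u n) _))//.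
by rewrite [ltRHS]splitr ltrD// hnormC.
Qed.

(* Minimizing sequences of [x |-> |x|^2 - 2 phi x] are Cauchy by the
   parallelogram identity, and their limit represents [phi]. *)
Lemma riesz_representation (A : set E) (phi : E -> R) (C : R) :
  linear_subspace A -> hcomplete A ->
  (forall a x y, A x -> A y -> phi (a *: x + y) = a * phi x + phi y) ->
  (forall x, A x -> `|phi x| <= C * hnorm x) ->
  exists2 x, A x & forall y, A y -> phi y = inner y x.
Proof.
move=> sA cA lphi bphi; have [A0 SA] := sA.
pose J x := inner x x - 2 * phi x.
have hinf : has_inf (J @` A).
  split; first by exists (J 0), 0.
  (* Completing the square: [J x] is at least [(|x| - C)^2 - C^2]. *)
  exists (- C ^+ 2) => _ [x Ax <-]; rewrite /J -hnorm_sqr.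
  have := bphi x Ax; rewrite ler_norml => /andP[_] phix.
  have := sqr_ge0 (hnorm x - C); nra.
pose m := inf (J @` A).
have mJ x : A x -> m <= J x by move=> Ax; apply: ge_inf; [exact: hinf.2|exists x].
have /choice[u uP] : forall n : nat, exists x, A x /\ J x < m + n.+1%:R^-1.
  move=> n; have n0 : 0 < n.+1%:R^-1 :> R by rewrite invr_gt0.
  by have [_ [x Ax <-] Jx] := inf_adherent n0 hinf; exists x.
have Au n : A (u n) by have [] := uP n.
have Ju n : J (u n) < m + n.+1%:R^-1 by have [] := uP n.
have [r r0|x Ax ux] := cA u Au.
  (* Since [J] is at least [m] at the midpoint, half of [|u k - u l|^2] is at most the sum of the
     excesses of [J (u k)] and [J (u l)] over [m], each below [r^2 / 4]. *)
  have r8 : 0 < r ^+ 2 / 4 by rewrite divr_gt0// exprn_gt0.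
  have [N _ NP] := near_infty_natSinv_lt (PosNum r8).
  exists N => k l /NP/= Hk /NP/= Hl; rewrite hnorm_lt ?ltW//.
  have Amid : A (2^-1 *: (u k + u l)).
    by apply: subspaceZ => //; rewrite -[u k]scale1r; exact: SA.
  have phimid : phi (2^-1 *: (u k + u l)) = 2^-1 * (phi (u k) + phi (u l)).
    have Akl : A (u k + u l) by rewrite -[u k]scale1r; exact: SA.
    have phi0 : phi 0 = 0.
      by have := lphi 1 0 0 A0 A0; rewrite scale1r addr0; lra.
    rewrite -[X in phi X]addr0 lphi// phi0 addr0 -{1}[u k]scale1r lphi//.
    by rewrite mul1r.
  have := mJ _ Amid.
  have := lt_trans (Ju k) (ler_ltD (lexx m) Hk).
  have := lt_trans (Ju l) (ler_ltD (lexx m) Hl).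
  rewrite /J phimid innerZl innerZr !innerDl !innerDr !innerNl !innerNr.
  rewrite (innerC (u l) (u k)); lra.
exists x => // y Ay; apply/eqP; rewrite -subr_eq0 -normr_eq0.
set g := phi y - _; suff: forall r, 0 < r -> `|g| <= r * (hnorm y + (inner y y + 1)).
  move=> H; rewrite eq_le normr_ge0 andbT; apply/ler_addgt0Pr => r r0.
  have c0 : 0 < hnorm y + (inner y y + 1).
    by have := hnorm_ge0 y; have := inner_ge0 y; lra.
  by rewrite add0r (le_trans (H (r / _) (divr_gt0 r0 c0)))// divfK// gt_eqF.
move=> r r0.
have rr0 : 0 < r ^+ 2 by rewrite exprn_gt0.
have [n [unx nr]] : exists n, hnorm (u n - x) < r /\ n.+1%:R^-1 < r ^+ 2.
  have [n _ nP] := filterI (ux r r0) (near_infty_natSinv_lt (PosNum rr0)).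
  by exists n; exact: nP (leqnn n).
(* As [u n] minimizes [J] up to [1/(n+1)], the quadratic [J (t y + u n) - J (u n)] in [t] is at
   least [-1/(n+1)], which forces its linear coefficient to be small. *)
have gn : (inner y (u n) - phi y) ^+ 2 <= n.+1%:R^-1 * (inner y y + 1).
  apply: quadratic_lower_bound => [|t]; first exact: inner_ge0.
  have := mJ _ (SA t y (u n) Ay (Au n)); have := Ju n.
  move: (n.+1%:R^-1) => b.
  rewrite /J lphi// innerDl !innerDr !innerZl !innerZr (innerC (u n) y); lra.
have q1 : 1 <= inner y y + 1 by have := inner_ge0 y; lra.
have gn' : `|inner y (u n) - phi y| <= r * (inner y y + 1).
  have rq0 : 0 <= r * (inner y y + 1) by apply: mulr_ge0; lra.
  rewrite -ler_sqr ?nnegrE// real_normK ?num_real// (le_trans gn)// exprMn.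
  by apply: ler_pM; rewrite ?invr_ge0 ?(ltW nr)//; [lra|nra].
have -> : g = (inner y (u n - x)) - (inner y (u n) - phi y).
  by rewrite /g innerBr; ring.
rewrite (le_trans (ler_normB _ _))// mulrDr lerD//.
by rewrite (le_trans (cauchy_schwarz _ _))// mulrC ler_wpM2r ?hnorm_ge0 ?ltW.
Qed.

End semi_inner_theory.

(** * Bounded linear operators on subspaces and their adjoints *)

Section bounded.
Context {R : realType} {E F : semiInnerType R}.
Implicit Types (A : set E) (D : E -> F).

Lemma linear_on0 A D : linear_subspace A -> linear_on A D -> D 0 = 0.
Proof.
move=> [A0 _] lD; have := lD 1 0 0 A0 A0; rewrite !scale1r addr0 => /eqP.
by rewrite -subr_eq0 opprD addrA subrr sub0r oppr_eq0 => /eqP.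
Qed.

Lemma linear_onZ A D a x : linear_subspace A -> linear_on A D -> A x ->
  D (a *: x) = a *: D x.
Proof.
move=> sA lD Ax; rewrite -[X in D X]addr0 lD//; last exact: sA.1.
by rewrite (linear_on0 sA lD) addr0.
Qed.

Lemma linear_onB A D x y : linear_subspace A -> linear_on A D -> A x -> A y ->
  D (x - y) = D x - D y.
Proof.
by move=> sA lD Ax Ay; rewrite addrC -scaleN1r lD// scaleN1r addrC.
Qed.

Definition bounded_on A D : Prop :=
  exists C, 0 <= C /\ forall x, A x -> hnorm (D x) <= C * hnorm x.

Lemma continuous_bounded_on A D : linear_subspace A -> linear_on A D ->
  continuous_on A D -> bounded_on A D.
Proof.
move=> sA lD cD; have [eta eta0 etaP] := cD 0 sA.1 1 ltr01.
exists (2 / eta); split; first by rewrite divr_ge0// ltW.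
move=> x Ax; apply/ler_addgt0Pr => r r0.
(* Rescaling by [hnorm x] would fail for null vectors; the slack keeps [b] positive and adds exactly
   [r] to the bound [2 / eta * b]. *)
pose b := hnorm x + r * eta / 2.
have b0 : 0 < b.
  by rewrite /b ltr_wpDl ?hnorm_ge0// divr_gt0// mulr_gt0.
pose a := eta / 2 / b.
have a0 : 0 < a by rewrite !divr_gt0.
have := etaP _ (subspaceZ a sA Ax).
rewrite (linear_on0 sA lD) !subr0 (linear_onZ a sA lD Ax) !hnormZ gtr0_norm//.
have xb : hnorm x <= b by rewrite /b lerDl divr_ge0// mulr_ge0// ltW.
have ab : a * hnorm x < eta.
  rewrite (@le_lt_trans _ _ (eta / 2))//; last by lra.
  rewrite /a -mulrA ler_piMr//; first by rewrite ltW// divr_gt0.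
  by rewrite mulrC ler_pdivrMr// mul1r.
move=> /(_ ab); rewrite -ltr_pdivlMl// mulr1 => /ltW /le_trans; apply.
suff -> : a^-1 = 2 / eta * hnorm x + r by [].
have eta_neq0 : eta != 0 by rewrite gt_eqF.
have b_neq0 : b != 0 by rewrite gt_eqF.
have -> : a^-1 = 2 / eta * b by rewrite /a; field; rewrite eta_neq0.
by rewrite /b; field.
Qed.

Lemma bounded_continuous_on A D : linear_subspace A -> linear_on A D ->
  bounded_on A D -> continuous_on A D.
Proof.
move=> sA lD [C [C0 bD]] x Ax r r0.
have C1 : 0 < C + 1 by rewrite ltr_wpDl.
exists (r / (C + 1)) => [|y Ay xy]; first exact: divr_gt0.
rewrite -(linear_onB sA lD Ay Ax) (le_lt_trans (bD _ (subspaceB sA Ay Ax)))//.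
move: xy; rewrite ltr_pdivlMr//; have := hnorm_ge0 (y - x); nra.
Qed.

(** [adjoint] is a choice, so a representative has to exist: Riesz gives one, the functional
    [y |-> inner (D y) w] being bounded by Cauchy-Schwarz. *)
Lemma adjointP A D w : linear_subspace A -> hcomplete A -> linear_on A D ->
  continuous_on A D ->
  A (adjoint A D w) /\
  forall y, A y -> inner (D y) w = inner y (adjoint A D w).
Proof.
move=> sA cA lD /(continuous_bounded_on sA lD)[C [C0 bD]].
rewrite /adjoint; case: xgetP => [x -> //|noadj].
have [||x Ax xP] := @riesz_representation R E A (fun y => inner (D y) w)
  (C * hnorm w) sA cA.
- by move=> a x y Ax Ay; rewrite lD// innerDl innerZl.
- move=> x Ax; rewrite (le_trans (cauchy_schwarz _ _))// mulrAC.
  by rewrite ler_wpM2r ?hnorm_ge0 ?bD.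
by case: (noadj x).
Qed.

(** A point of the closure is approximated by some [y] in [A], and boundedness makes [D y]
    approximate its image. *)
Lemma bounded_hclosure A (B : set F) D : linear_subspace A ->
  linear_on (hclosure A) D -> bounded_on (hclosure A) D -> (forall x, A x -> B (D x)) ->
  forall x, hclosure A x -> hclosure B (D x).
Proof.
move=> /hclosure_subspace sA lD [C [C0 bD]] AB x Ax r r0.
have C1 : 0 < C + 1 by rewrite ltr_wpDl.
have [y Ay xy] := Ax (r / (C + 1)) (divr_gt0 r0 C1).
have cAy := subset_hclosure Ay.
exists (D y); first exact: AB.
rewrite -(linear_onB sA lD Ax cAy) (le_lt_trans (bD _ (subspaceB sA Ax cAy)))//.
move: xy; rewrite ltr_pdivlMr//; have := hnorm_ge0 (x - y); nra.
Qed.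

End bounded.

(** * Completeness of L^2 and of direct sums *)

Section L2_complete.
Context d (Z : measurableType d) (R : realType).
Variable mu : {measure set Z -> \bar R}.
Implicit Types f g : L2 mu.

Lemma L2_innerE f : (inner f f)%:E = (\int[mu]_z ((f z) ^+ 2)%:E)%E.
Proof.
have fi := Lfun2_integrable_sqr (LfunP f).
rewrite /inner/= /Rintegral; under eq_integral do rewrite -expr2.
by rewrite fineK//; exact: integrable_fin_num fi.
Qed.

Lemma L2_inner0_ae f g : inner (f - g) (f - g) = 0 -> f = g %[ae mu].
Proof.
move=> fg0; have := L2_innerE (f - g); rewrite fg0 => /esym fg.
have mfg : measurable_fun [set: Z] (EFin \o (fun z => (f z - g z) ^+ 2 : R)).
  by apply/measurable_EFinP/measurable_funX/measurable_funB.
have : ae_eq mu [set: Z] (EFin \o (fun z => (f z - g z) ^+ 2 : R)) (cst 0%E).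
  apply/ae_eq_integral_abs => //; rewrite -[RHS]fg.
  by apply: eq_integral => z _; rewrite gee0_abs// lee_fin sqr_ge0.
apply: filterS => z /(_ I)[/eqP]; rewrite sqrf_eq0 subr_eq0 => /eqP fgz _.
exact: fgz.
Qed.

Lemma square_integrable_Lfun (g : Z -> R) : measurable_fun [set: Z] g ->
  (\int[mu]_z ((g z) ^+ 2)%:E < +oo)%E -> g \in Lfun mu 2%:E.
Proof.
move=> mg gfin; rewrite inE; apply/andP; split; rewrite inE//=.
rewrite /finite_norm unlock poweR_lty//.
rewrite (eq_integral (fun z => (g z ^+ 2)%:E))// => z _ /=.
by rewrite powR_mulrn// real_normK ?num_real.
Qed.

(* The subsequence [v] satisfies [|v_(k+1) - v_k| <= 2^-k] in [L^2]. As
   [2 |t| <= 2^k t^2 + 2^-k], integrability of [\sum_k 2^k (v_(k+1) - v_k)^2]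
   gives convergence a.e., and Fatou's lemma convergence in [L^2]. *)
Lemma L2_complete : hcomplete [set: L2 mu].
Proof.
move=> u _ cu.
have /choice[N NP] : forall k : nat, exists N, forall m n, (N <= m)%N ->
    (N <= n)%N -> hnorm (u m - u n) < 2^-1 ^+ k.
  by move=> k; apply: cu; rewrite exprn_gt0.
(* Summing the [(N i).+1] makes [phi] monotone and places [phi k] above both [N k] and [k]. *)
pose phi k := (\sum_(i < k.+1) (N i).+1)%N.
have phiN k : (N k <= phi k)%N by rewrite /phi big_ord_recr/=; lia.
have phik k : (k < phi k)%N.
  elim: k => [|k ih]; first by rewrite /phi big_ord1.
  by rewrite /phi big_ord_recr/= -/(phi k); lia.
have phiS k : (phi k <= phi k.+1)%N.
  by rewrite [in leqRHS]/phi big_ord_recr/= leq_addr.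
pose v k := u (phi k).
pose dd k (z : Z) : R := 2 ^+ k * (v k.+1 z - v k z) ^+ 2.
have mv k : measurable_fun [set: Z] (v k) by [].
have md k : measurable_fun [set: Z] (EFin \o dd k).
  apply/measurable_EFinP/measurable_funM => //.
  exact/measurable_funX/measurable_funB.
have dd0 k z : (0 <= (EFin \o dd k) z)%E.
  by rewrite lee_fin mulr_ge0 ?sqr_ge0 ?exprn_ge0.
pose G z := (\sum_(k <oo) (EFin \o dd k) z)%E.
have mG : measurable_fun [set: Z] G.
  by apply: ge0_emeasurable_sum => // k z _ _; exact: dd0.
have G0 z : (0 <= G z)%E by apply: nneseries_ge0 => k _ _; exact: dd0.
(* The term of index [k] integrates to at most [2^k (2^-k)^2 = 2^-k], and the sum of these is at
   most 2. *)
have Gint : mu.-integrable [set: Z] G.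
  apply/integrableP; split=> //.
  under eq_integral do rewrite gee0_abs//.
  rewrite integral_nneseries//.
  apply: (@le_lt_trans _ _ (\sum_(k <oo) (2^-1 ^+ k)%:E)%E).
    apply: lee_nneseries => [k _ _|k _]; first exact: integral_ge0.
    under eq_integral do rewrite /= /dd EFinM.
    have hm : measurable_fun [set: Z] (fun z => ((v k.+1 z - v k z) ^+ 2)%:E).
      exact/measurable_EFinP/measurable_funX/measurable_funB.
    rewrite ge0_integralZl// ?lee_fin ?exprn_ge0//; last first.
      by move=> z _; rewrite lee_fin sqr_ge0.
    rewrite -[X in (_ * X)%E](L2_innerE (v k.+1 - v k)) -EFinM lee_fin.
    have := NP k (phi k.+1) (phi k) (leq_trans (phiN k) (phiS k)) (phiN k).
    rewrite hnorm_lt ?exprn_ge0// => /ltW le2.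
    rewrite (le_trans (ler_wpM2l (exprn_ge0 k (ler0n R 2)) le2))//.
    by rewrite expr2 mulrA -exprMn divff// expr1n mul1r.
  apply: (@le_lt_trans _ _ 2%:E); last exact: ltry.
  apply: lime_le.
    by apply: is_cvg_nneseries => k _ _; rewrite lee_fin exprn_ge0.
  apply: nearW => n; rewrite sumEFin lee_fin.
  suff -> : \sum_(0 <= k < n) 2^-1 ^+ k = 2 - 2 * 2^-1 ^+ n :> R.
    by rewrite gerBl mulr_ge0// exprn_ge0.
  elim: n => [|n ih]; first by rewrite big_nil; ring.
  by rewrite big_nat_recr//= ih exprS; field.
have vcvg z : G z \is a fin_num -> cvgn (fun k => v k z).
  move=> Gfin.
  have cdd : cvgn (series (dd ^~ z)).
    apply: nondecreasing_is_cvgn.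
      apply: nondecreasing_series => k _ _; exact: dd0.
    exists (fine (G z)) => _ [n _ <-].
    rewrite -lee_fin fineK// /series/= -sumEFin.
    by apply: nneseries_lim_ge => k _ _; exact: dd0.
  have ct : cvgn (series (telescope (v ^~ z))).
    apply: normed_cvg.
    apply: (@series_le_cvg _ _ (fun k => dd k z + geometric 1 2^-1 k)).
    - by move=> k; exact: normr_ge0.
    - move=> k; apply: addr_ge0; [exact: dd0|exact: geometric_ge0].
    - move=> k; rewrite /= [X in `|X| <= _](_ : _ = v k.+1 z - v k z)//.
      rewrite /dd mul1r exprVn.
      move: (v k.+1 z - v k z) => t; have p0 : 0 < 2 ^+ k :> R by rewrite exprn_gt0.
      rewrite -(ler_pM2l p0) mulrDr divff ?gt_eqF// -(real_normK (num_real t)).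
      move: (2 ^+ k) p0 (`|t|) (normr_ge0 t) => p p0 y y0.
      have := sqr_ge0 (p * y - 1); have := mulr_ge0 (ltW p0) y0.
      nra.
    - apply: is_cvg_seriesD => //; apply: is_cvg_geometric_series.
      by rewrite ger0_norm// invf_lt1// ltr1n.
  rewrite (_ : (fun k => v k z) = fun k => v 0%N z + series (telescope (v ^~ z)) k).
    by apply: is_cvgD => //; exact: is_cvg_cst.
  by apply/funext => k; rewrite -eq_sum_telescope.
(* An upper limit is measurable whether or not the sequence converges, and is the limit wherever
   [G z] is finite; [fine] sends infinite values to 0. *)
pose f z := fine (limn_esup (fun k => (v k z)%:E)).
have mf : measurable_fun [set: Z] f.
  apply: measurableT_comp => //; apply: measurable_fun_limn_esup => k.
  exact/measurable_EFinP.
have fE z : G z \is a fin_num -> (fun k => v k z) @ \oo --> f z.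
  move=> /vcvg /cvg_ex[l vl].
  have : (EFin \o (fun k => v k z)) @ \oo --> l%:E.
    by apply: cvg_EFin => //; exact: nearW.
  by move=> /cvg_limn_einf_sup[_ fl]; rewrite /f fl.
(* Fatou's lemma passes to the limit in [k]. It serves twice: with [c = 1] for the integrability of
   [u M - f], then with [c = r / 2] for convergence. *)
have fatou_le c m : 0 <= c -> (\forall k \near \oo, hnorm (u m - v k) <= c) ->
    (\int[mu]_z ((u m z - f z) ^+ 2)%:E <= (c ^+ 2)%:E)%E.
  move=> c0 [K _ KP].
  pose h k z := ((u m z - v k z) ^+ 2)%:E.
  have mh k : measurable_fun [set: Z] (h k).
    by apply/measurable_EFinP/measurable_funX/measurable_funB.
  have h0 k z : [set: Z] z -> (0 <= h k z)%E by rewrite lee_fin sqr_ge0.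
  rewrite (@ge0_ae_eq_integral _ _ _ mu _ _ (fun z => limn_einf (h ^~ z)))//.
  - apply: (le_trans (fatou mu measurableT mh h0)).
    rewrite limn_einf_lim; apply: lime_le.
      exact: is_cvg_einfs.
    exists K => // k Kk; apply: (@le_trans _ _ (\int[mu]_z h k z)%E).
      by apply: ereal_inf_lbound; exists k => //=.
    by rewrite -[X in (X <= _)%E](L2_innerE (u m - v k)) lee_fin -hnorm_le// KP.
  - by apply/measurable_EFinP/measurable_funX/measurable_funB.
  - rewrite (_ : (fun z => _) = fun z => - limn_esup (fun k => - h k z))%E.
      apply: measurableT_comp => //; apply: measurable_fun_limn_esup => k.
      exact: measurableT_comp.
    apply/funext => z; rewrite -limn_einfN; congr limn_einf.
    by apply/funext => k; exact/esym/oppeK.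
  - by move=> z _; rewrite lee_fin sqr_ge0.
  - move=> z _; rewrite limn_einf_lim; apply: lime_ge; first exact: is_cvg_einfs.
    by apply: nearW => k; apply: le_ereal_inf_tmp => _ [l /= _ <-]; exact: h0.
  - apply: filterS (integrable_ae measurableT Gint) => z /(_ I) Gz _.
    have : h ^~ z @ \oo --> ((u m z - f z) ^+ 2)%:E.
      apply: cvg_EFin; first exact: nearW.
      have uv : (fun k => u m z - v k z) @ \oo --> u m z - f z.
        by apply: cvgB; [exact: cvg_cst|exact: fE].
      exact: (cvgM uv uv).
    by move=> /cvg_limn_einf_sup[-> _].
have ev r m M : (forall n, (M <= n)%N -> hnorm (u m - u n) < r) ->
    \forall k \near \oo, hnorm (u m - v k) <= r.
  move=> H; exists M => // k Mk; apply/ltW/H.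
  by rewrite (leq_trans Mk)// ltnW.
have [M MP] := cu 1 ltr01.
have wfin := fatou_le 1 M ler01 (ev 1 M M (fun n => MP M n (leqnn M))).
have wL : (fun z => u M z - f z) \in Lfun mu 2%:E.
  apply: square_integrable_Lfun; first exact: measurable_funB.
  exact: le_lt_trans wfin (ltry _).
(* Only [u M - f] is known to be square integrable; [f] is recovered in [L2 mu] as [u M - w]. *)
pose w : L2 mu := Lfun_Sub (lee1n 2) wL.
have xE z : (u M - w) z = f z by rewrite /= opprB addrC subrK.
exists (u M - w) => // r r0.
have [K KP] := cu (r / 2) (divr_gt0 r0 (ltr0Sn _ 1)).
exists K => // m Km; have r20 : 0 <= r / 2 by rewrite divr_ge0// ltW.
rewrite (@le_lt_trans _ _ (r / 2))//; last by lra.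
rewrite hnorm_le// -lee_fin L2_innerE.
under eq_integral => z _ do rewrite [_ z]/(u m z - (u M - w) z) xE.
by apply: fatou_le => //; apply: (ev _ _ K) => n; exact: KP.
Qed.
End L2_complete.

Section completeness.
Context {R : realType}.

Lemma hnorm_norm (W : hilbertType R) (x : W) : hnorm x = `|x|.
Proof. by rewrite norm_inner. Qed.

Lemma hilbert_complete (W : hilbertType R) : hcomplete [set: W].
Proof.
move=> u _ cu; have /cauchy_cvgP/cvg_ex[x ux] : cauchy (u @ \oo).
  apply/cauchy_ballP => e e0; have [N NP] := cu e e0.
  pose A := [set u k | k in [set k | (N <= k)%N]].
  exists (A, A); first by split; exists N => // k Nk; exists k.
  by move=> [_ _] [[k Nk <-] [l Nl <-]]; rewrite -ball_normE/= -hnorm_norm NP.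
exists x => // r r0; move/cvgrPdist_lt : ux => /(_ r r0).
by apply: filterS => n; rewrite hnorm_norm distrC.
Qed.

Lemma hnorm_dsum_component (I : finType) (W : I -> semiInnerType R) (x : dsum W) i :
  hnorm (x i) <= hnorm x.
Proof.
rewrite hnorm_le ?hnorm_ge0// hnorm_sqr [leRHS]/inner/= (bigD1 i)//= lerDl.
by apply: sumr_ge0 => j _; exact: inner_ge0.
Qed.

Lemma hnorm_dsum_le (I : finType) (W : I -> semiInnerType R) (x : dsum W) :
  hnorm x <= \sum_i hnorm (x i).
Proof.
have s0 : 0 <= \sum_i hnorm (x i) by apply: sumr_ge0 => i _; exact: hnorm_ge0.
rewrite hnorm_le// [leLHS]/inner/=.
suff [] : \sum_i inner (x i) (x i) <= (\sum_i hnorm (x i)) ^+ 2 /\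
          0 <= \sum_i hnorm (x i) by [].
elim/big_ind2 : _ => [|a b c e [ab b0] [ce e0]|i _].
- by rewrite expr0n.
- by split; [nra|exact: addr_ge0].
- by rewrite hnorm_sqr hnorm_ge0.
Qed.

Lemma dsum_complete (J : finType) (W : J -> semiInnerType R) :
  (forall i, hcomplete [set: W i]) -> hcomplete [set: dsum W].
Proof.
move=> cW u _ cu.
pose x : dsum W := fun i => xget 0 [set y | hcvg (u ^~ i) y].
have xP i : hcvg (u ^~ i) (x i).
  have [r r0|y _ uy] := cW i (u ^~ i) (fun=> I); last first.
    by rewrite /x; case: xgetP => [//|/(_ y)].
  have [N NP] := cu r r0; exists N => m n Nm Nn.
  exact: le_lt_trans (hnorm_dsum_component (u m - u n) i) (NP _ _ Nm Nn).
exists x => // r r0.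
(* The successor keeps the quotient positive for empty [J], as for a node without parents. *)
have c0 : 0 < r / #|J|.+1%:R by rewrite divr_gt0.
have : \forall n \near \oo, forall i, hnorm (u n i - x i) < r / #|J|.+1%:R.
  by apply: filter_forall => i; exact: xP.
apply: filterS => n un; rewrite (le_lt_trans (hnorm_dsum_le _))//.
rewrite (@le_lt_trans _ _ (\sum_(i : J) r / #|J|.+1%:R))//.
  by apply: ler_sum => i _; exact/ltW/un.
rewrite sumr_const -[ltLHS]mulr_natr mulrAC ltr_pdivrMr// ltr_pM2l//.
by rewrite ltr_nat cardT.
Qed.

Lemma hnorm_pair_fst (E F : semiInnerType R) (x : E * F) : hnorm x.1 <= hnorm x.
Proof.
by rewrite hnorm_le ?hnorm_ge0// hnorm_sqr [leRHS]/inner/= lerDl inner_ge0.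
Qed.

Lemma hnorm_pair_snd (E F : semiInnerType R) (x : E * F) : hnorm x.2 <= hnorm x.
Proof.
by rewrite hnorm_le ?hnorm_ge0// hnorm_sqr [leRHS]/inner/= lerDr inner_ge0.
Qed.

Lemma hnorm_pair_le (E F : semiInnerType R) (x : E * F) :
  hnorm x <= hnorm x.1 + hnorm x.2.
Proof.
rewrite hnorm_le ?addr_ge0 ?hnorm_ge0// [leLHS]/inner/= -!hnorm_sqr.
by have := hnorm_ge0 x.1; have := hnorm_ge0 x.2; nra.
Qed.

Lemma setX_complete (E F : semiInnerType R) (A : set E) (B : set F) :
  hcomplete A -> hcomplete B -> hcomplete (A `*` B).
Proof.
move=> cA cB u ABu cu.
have [r r0|x Ax ux] := cA (fun n => (u n).1) (fun n => (ABu n).1).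
  have [N NP] := cu r r0; exists N => m n Nm Nn.
  exact: le_lt_trans (hnorm_pair_fst (u m - u n)) (NP _ _ Nm Nn).
have [r r0|y By uy] := cB (fun n => (u n).2) (fun n => (ABu n).2).
  have [N NP] := cu r r0; exists N => m n Nm Nn.
  exact: le_lt_trans (hnorm_pair_snd (u m - u n)) (NP _ _ Nm Nn).
exists (x, y) => // r r0; have r20 := divr_gt0 r0 (ltr0Sn _ 1).
apply: filterS (filterI (ux _ r20) (uy _ r20)) => n [unx uny].
by rewrite (le_lt_trans (hnorm_pair_le _))// [ltRHS]splitr ltrD.
Qed.

Lemma setX_subspace (E F : semiInnerType R) (A : set E) (B : set F) :
  linear_subspace A -> linear_subspace B -> linear_subspace (A `*` B).
Proof.
move=> [A0 SA] [B0 SB]; split => // a x y [Ax1 Bx2] [Ay1 By2].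
by split; [exact: SA|exact: SB].
Qed.

End completeness.

(** * Forward evaluation and backpropagation *)

Section forward_theory.
Context (R : realType) (n : nat) (pa : 'I_n.+1 -> {set 'I_n.+1}).
Hypothesis pa_lt : forall i j : 'I_n.+1, i \in pa j -> (i < j)%N.
Context (W : 'I_n.+1 -> hilbertType R).

Lemma restrict_pa_eq (a b : forall i, W i) (j : 'I_n.+1) :
  (forall i : 'I_n.+1, (i < j)%N -> a i = b i) ->
  restrict_pa (pa := pa) a j = restrict_pa b j.
Proof.
move=> ab; apply/functional_extensionality_dep => p.
by apply: ab; apply: pa_lt; exact: (valP p).
Qed.

Context d (Z : measurableType d).
Variable theta : forall j, probability Z R -> Wpa pa W j -> W j.

Lemma foldl_forward_out (Q : probability Z R) s (h : forall i, W i) i :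
  i \notin s -> foldl (forward_step theta Q) h s i = h i.
Proof.
elim: s h => //= j s ih h; rewrite inE negb_or => /andP[ij /ih ->].
by rewrite /forward_step dfwithout// eq_sym.
Qed.

(** The enumeration is increasing and each node is written once, so the parents of [j] already have
    their final values when [j] is reached. As [theta] is arbitrary, this also applies to the
    recursion on differentials. *)
Lemma forwardE (Q : probability Z R) (j : 'I_n.+1) :
  forward theta Q j = theta Q (restrict_pa (forward theta Q) j).
Proof.
pose e := enum 'I_n.+1.
have je : (j < size e)%N by rewrite size_enum_ord.
have eE : e = take j e ++ j :: drop j.+1 e.
  by rewrite -[LHS](cat_take_drop j) (drop_nth j)// nth_ord_enum.
have inlt i : (i \in take j e) = (i < j)%N.
  by rewrite in_take ?mem_enum// index_enum_ord.
have := enum_uniq 'I_n.+1; rewrite -/e eE cat_uniq => /and3P[_ /hasPn disj].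
rewrite cons_uniq => /andP[jdrop _].
pose h := foldl (forward_step theta Q) (fun=> 0) (take j e).
have fE : forward theta Q =
    foldl (forward_step theta Q) h (j :: drop j.+1 e).
  by rewrite /forward -/e {1}eE foldl_cat.
have -> : restrict_pa (pa := pa) (forward theta Q) j = restrict_pa h j.
  apply: restrict_pa_eq => i ij; rewrite fE foldl_forward_out//.
  by apply/negP => /disj/=; rewrite inlt ij.
by rewrite fE/= foldl_forward_out// /forward_step dfwithin.
Qed.

End forward_theory.

Lemma extend_paT (R : realType) n (pa : 'I_n.+1 -> {set 'I_n.+1})
    (W : 'I_n.+1 -> hilbertType R) (j : 'I_n.+1) (g : Wpa pa W j)
    (p : parent pa j) : extend_pa g (val p) = g p.
Proof.
(* The match is generalized over the reflection proof, whose type depends on [i], before it is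
   destructed; proof irrelevance identifies the membership proofs. *)
have matchT (T : Type) (Q : Prop) b (r : reflect Q b) (f : Q -> T) z (q : Q) :
    match r with ReflectT q => f q | ReflectF _ => z end = f q.
  by case: r => // q'; rewrite (Prop_irrelevance q' q).
case: p => i ij.
exact: (matchT (W i) _ _ (@idP (i \in pa j)) (fun ij => g (exist _ i ij)) 0 ij).
Qed.

Lemma extend_paF (R : realType) n (pa : 'I_n.+1 -> {set 'I_n.+1})
    (W : 'I_n.+1 -> hilbertType R) (j : 'I_n.+1) (g : Wpa pa W j) i :
  i \notin pa j -> extend_pa g i = 0.
Proof.
have matchF (T : Type) (Q : Prop) b (r : reflect Q b) (f : Q -> T) z :
    ~ Q -> match r with ReflectT q => f q | ReflectF _ => z end = z.
  by case: r.
move=> /negP.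
exact: (matchF (W i) _ _ (@idP (i \in pa j)) (fun ij => g (exist _ i ij)) 0).
Qed.

(** [extend_pa] is the transpose of [restrict_pa]. The predicate [D] allows sums over the nodes
    preceding [j] only. *)
Lemma sum_extend_pa (R : realType) n (pa : 'I_n.+1 -> {set 'I_n.+1})
    (W : 'I_n.+1 -> hilbertType R) (j : 'I_n.+1) (x : forall i, W i)
    (g : Wpa pa W j) (D : pred 'I_n.+1) : (forall i, i \in pa j -> D i) ->
  \sum_(i | D i) inner (x i) (extend_pa g i) = inner (restrict_pa x j) g.
Proof.
move=> paD.
rewrite (bigID (mem (pa j)))/= [X in _ + X]big1 ?addr0; last first.
  by move=> i /andP[_ /extend_paF ->]; rewrite innerC inner0l.
rewrite (eq_bigl (mem (pa j))); last first.
  by move=> i /=; rewrite andbC; case: (boolP (i \in pa j)) => //= /paD.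
rewrite [RHS]/inner/= (reindex_omap (val : parent pa j -> _) insub)/=; last first.
  by move=> i ij; rewrite insubT.
by apply: eq_big => [p|p _]; rewrite ?valK ?eqxx ?andbT ?extend_paT//; exact: valP.
Qed.

(** * One-sided little-o, and linear maps on closures of spans *)

Lemma littleo_rightP (R : realType) (f : R -> R) : (forall e, 0 <= f e) ->
  f =o_ (0^'+) (fun e : R => e) <->
  forall r, 0 < r -> \forall e \near 0^'+, f e <= r * e.
Proof.
move=> f0; split=> [/eqoP fo r r0|fo].
  apply: filterS (filterI (fo r r0) (nbhs_right_gt 0)) => e [+ e0].
  by rewrite ger0_norm// gtr0_norm.
apply/eqoP => r r0; apply: filterS (filterI (fo r r0) (nbhs_right_gt 0)) => e [+ e0].
by rewrite ger0_norm// gtr0_norm.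
Qed.

Section linear_closure.
Context {R : realType} {E F : semiInnerType R}.
Implicit Types (S : set E) (A : set E) (D : E -> F).

Lemma lspan_image S A (T : set F) D : linear_subspace A -> S `<=` A ->
  linear_on A D -> (forall x, S x -> T (D x)) ->
  forall x, lspan S x -> lspan T (D x).
Proof.
move=> sA SA lD ST x Sx.
(* Membership in [A] is carried along because [D] is linear on [A] only. *)
suff : lspan S `<=` [set x | A x /\ lspan T (D x)] by move=> /(_ x Sx)[].
have sT := lspan_subspace T.
apply: lspan_min => [|y Sy]; last by split; [exact: SA|exact/subset_lspan/ST].
split=> [|a y z [Ay Ty] [Az Tz]].
  by split; [exact: sA.1|rewrite (linear_on0 sA lD); exact: sT.1].
by split; [exact: sA.2|rewrite lD//; exact: sT.2].
Qed.

(** Agreement passes from [S] to its span by linearity, then to the closure by boundedness, where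
    the seminorm of [F] only yields a difference of norm 0. *)
Lemma linear_on_hclosure_unique S D D' :
  linear_on (hclosure (lspan S)) D -> linear_on (hclosure (lspan S)) D' ->
  bounded_on (hclosure (lspan S)) D -> bounded_on (hclosure (lspan S)) D' ->
  (forall x, S x -> D x = D' x) ->
  forall x, hclosure (lspan S) x -> hnorm (D x - D' x) = 0.
Proof.
set A := hclosure _ => lD lD' [C [C0 bD]] [C' [C'0 bD']] SD x Ax.
have sA : linear_subspace A by exact/hclosure_subspace/lspan_subspace.
have spanA : lspan S `<=` A by exact: subset_hclosure.
have DD' y : lspan S y -> D y = D' y.
  move=> Sy; suff : lspan S `<=` [set y | A y /\ D y = D' y] by move=> /(_ y Sy)[].
  apply: lspan_min => [|z Sz]; last first.
    by split; [exact/spanA/subset_lspan|exact: SD].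
  split=> [|a u v [Au uE] [Av vE]].
    by split; [exact: sA.1|rewrite (linear_on0 sA lD) (linear_on0 sA lD')].
  by split; [exact: sA.2|rewrite lD// lD'// uE vE].
apply/eqP; rewrite eq_le hnorm_ge0 andbT; apply/ler_addgt0Pr => r r0.
have c0 : 0 < C + C' + 1 by rewrite ltr_wpDl ?addr_ge0.
have [y Sy xy] := Ax (r / (C + C' + 1)) (divr_gt0 r0 c0).
have Ay := spanA _ Sy; rewrite add0r.
have -> : D x - D' x = D (x - y) - D' (x - y).
  rewrite (linear_onB sA lD Ax Ay) (linear_onB sA lD' Ax Ay) (DD' y Sy).
  by rewrite opprB addrA subrK.
rewrite (le_trans (ler_hnormB _ _))//.
have Axy := subspaceB sA Ax Ay.
rewrite (le_trans (lerD (bD _ Axy) (bD' _ Axy)))// -mulrDl.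
move: xy; rewrite ltr_pdivlMr//; have := hnorm_ge0 (x - y); nra.
Qed.

End linear_closure.

(** * The chain rule along the computation graph, and its transpose *)

Section composition.
Local Unset Implicit Arguments.
Context {R : realType} {d : measure_display} {Z : measurableType d}.
Context {M : set (probability Z R)} {n : nat} {pa : 'I_n.+1 -> {set 'I_n.+1}}.
Hypothesis pa_lt : forall i j : 'I_n.+1, i \in pa j -> (i < j)%N.
Context {W : 'I_n.+1 -> hilbertType R} {V : forall j : 'I_n.+1, set (W j)}.
Context {U : forall j : 'I_n.+1, set (Wpa pa W j)}.
Hypothesis sub_prodV_U : forall (j : 'I_n.+1) (u : Wpa pa W j),
  (forall i : parent pa j, V (val i) (u i)) -> U j u.
Context {theta : forall j : 'I_n.+1, probability Z R -> Wpa pa W j -> W j}.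
Hypothesis theta_V : forall (j : 'I_n.+1) (Q : probability Z R) (u : Wpa pa W j),
  M Q -> U j u -> V j (theta j Q u).
Context {P : probability Z R}.

Let h := forward theta P.
Let hpa j := restrict_pa (pa := pa) h j.
Let tot j := total_differential M (U j) (theta j) (P := P) (hpa j).
Let adj j := total_differential_adjoint M (U j) (theta j) P (hpa j).
Let A := model_tangent_space M P.
Let B j := set_tangent_space (U j) (hpa j).

Hypothesis theta_diff : forall j : 'I_n.+1,
  totally_pathwise_differentiable M (U j) (theta j) P (hpa j).

(* The chain rule: the derivative of the forward evaluation in the direction
   [s] is itself a forward evaluation, of the differentials of the primitives. *)
Definition dforward (s : L2 P) : forall i, W i :=
  forward (fun j (_ : probability Z R) g => tot j (s, g)) P.

Lemma dforwardE s j : dforward s j = tot j (s, restrict_pa (dforward s) j).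
Proof. by rewrite /dforward forwardE. Qed.

Lemma tot_is_differential j :
  is_total_differential M (U j) (theta j) (hpa j) (tot j).
Proof.
have [D DP] := theta_diff j.
by rewrite /tot /total_differential; case: xgetP => [D' -> //|/(_ D)].
Qed.

Lemma tangent_space_subspace : linear_subspace A.
Proof. exact/hclosure_subspace/lspan_subspace. Qed.

Lemma set_tangent_space_subspace j : linear_subspace (B j).
Proof. exact/hclosure_subspace/lspan_subspace. Qed.

Lemma forward_in (Q : probability Z R) j : M Q -> V j (forward theta Q j).
Proof.
move=> MQ; have [m] := ubnP (j : nat); elim: m j => // m ih j jm.
rewrite forwardE//; apply: theta_V => //; apply: sub_prodV_U => p.
by apply: ih; rewrite (leq_trans (pa_lt _ _ (valP p))).
Qed.

(** First-order expansions at the finitely many parents add up to one in the direct sum, which gives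
    the path needed to differentiate the primitive at [j]. *)
Lemma set_path_forward s Pe j : model_path M s Pe ->
  (forall i, i \in pa j -> forall r, 0 < r -> \forall e \near 0^'+,
    hnorm (forward theta (Pe e) i - h i - e *: dforward s i) <= r * e) ->
  set_path (U j) (hpa j) (restrict_pa (dforward s) j)
    (fun e => restrict_pa (forward theta (Pe e)) j).
Proof.
move=> [MPe _ _] dpa; split=> [e /MPe Me|].
  by apply: sub_prodV_U => p; exact: forward_in.
apply/littleo_rightP => [e|r r0]; first exact: hnorm_ge0.
have c0 : 0 < r / #|parent pa j|.+1%:R by rewrite divr_gt0.
have : \forall e \near 0^'+, forall p : parent pa j,
    hnorm (forward theta (Pe e) (val p) - h (val p) - e *: dforward s (val p))
    <= r / #|parent pa j|.+1%:R * e.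
  by apply: filter_forall => p; apply: dpa => //; exact: (valP p).
move=> /filterI /(_ (nbhs_right_gt 0)); apply: filterS => e [pe e0].
rewrite (le_trans (hnorm_dsum_le _))//.
apply: (@le_trans _ _ (\sum_(p : parent pa j) r / #|parent pa j|.+1%:R * e)).
  by apply: ler_sum => p _; exact: pe.
rewrite sumr_const -[leLHS]mulr_natr mulrAC ler_pM2r// mulrAC ler_pdivrMr//.
by rewrite ler_pM2l// ler_nat leqnSn.
Qed.

(** Strong induction on the node; [r] is generalized because the parents are needed with other
    constants. *)
Lemma forward_differentiable s Pe j r : model_path M s Pe -> 0 < r ->
  \forall e \near 0^'+,
    hnorm (forward theta (Pe e) j - h j - e *: dforward s j) <= r * e.
Proof.
move=> sPe; have [m] := ubnP (j : nat); elim: m j r => // m ih j r jm r0.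
have path_j : set_path (U j) (hpa j) (restrict_pa (dforward s) j)
    (fun e => restrict_pa (forward theta (Pe e)) j).
  apply: set_path_forward => // i ij r' r'0.
  by apply: ih => //; rewrite (leq_trans (pa_lt _ _ ij)).
have [_ _ /(_ _ _ _ _ sPe path_j)] := tot_is_differential j.
move=> /(littleo_rightP (fun e => hnorm_ge0 _)) /(_ r r0).
have hE : h j = theta j P (hpa j) by exact: forwardE.
apply: filterS => e; rewrite -dforwardE -hE.
by rewrite -(@forwardE _ _ _ pa_lt).
Qed.

(** A submodel with score [s] moves the parents along a path in [U j] with direction [g s]. So [g]
    maps scores to tangent directions, hence spans to spans by linearity and closures to closures by
    boundedness. *)
Lemma dforward_parents_tangent j : (forall i, i \in pa j ->
    linear_on A (dforward ^~ i) /\ bounded_on A (dforward ^~ i)) ->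
  let g := fun s => restrict_pa (dforward s) j : Wpa pa W j in
  [/\ linear_on A g, bounded_on A g & forall s, A s -> B j (g s)].
Proof.
move=> lb g; have sA := tangent_space_subspace.
have lg : linear_on A g.
  move=> a s t As At; apply/functional_extensionality_dep => p.
  by have [+ _] := lb _ (valP p); apply.
have bg : bounded_on A g.
  have cP (p : parent pa j) : exists C, 0 <= C /\ forall s, A s ->
    hnorm (dforward s (val p)) <= C * hnorm s := (lb _ (valP p)).2.
  have [C CP] := choice cP.
  exists (\sum_p C p); split; first by apply: sumr_ge0 => p _; have [] := CP p.
  move=> s As; rewrite (le_trans (hnorm_dsum_le _))// mulr_suml.
  by apply: ler_sum => p _; have [_] := CP p; apply.
have SA : model_tangent_set M P `<=` A.
  by apply: subset_trans (@subset_hclosure _ _ _); exact: subset_lspan.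
split=> //; apply: (bounded_hclosure (lspan_subspace _) lg bg).
apply: (lspan_image sA SA lg) => t [Pe tPe].
exists (fun e => restrict_pa (forward theta (Pe e)) j).
apply: set_path_forward => // i _ r r0.
exact: forward_differentiable.
Qed.

(** Strong induction: [tot j] is controlled only on [A] times [B j], so the derivatives of the
    parents must first be shown to lie in [B j]. *)
Lemma dforward_linear_bounded j :
  linear_on A (dforward ^~ j) /\ bounded_on A (dforward ^~ j).
Proof.
have [m] := ubnP (j : nat); elim: m j => // m ih j jm.
have [|lg bg gB] := @dforward_parents_tangent j.
  by move=> i ij; apply: ih; rewrite (leq_trans (pa_lt _ _ ij)).
have [ltot ctot _] := tot_is_differential j.
have sAB := setX_subspace tangent_space_subspace (set_tangent_space_subspace j).
have [C [C0 btot]] := continuous_bounded_on sAB ltot ctot.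
have [C' [C'0 bg']] := bg.
have ABg s : A s -> (A `*` B j) (s, restrict_pa (dforward s) j).
  by move=> As; split=> //; exact: gB.
split=> [a s t As At|].
  rewrite (dforwardE (a *: s + t) j) (dforwardE s j) (dforwardE t j).
  have E := ltot a _ _ (ABg s As) (ABg t At).
  apply: etrans E; congr (tot j _).
  exact: (congr1 (pair (a *: s + t)) (lg a s t As At)).
exists (C * (1 + C')); split; first by rewrite mulr_ge0 ?addr_ge0.
move=> s As; rewrite dforwardE (le_trans (btot _ (ABg s As)))//.
rewrite -mulrA ler_wpM2l// (le_trans (hnorm_pair_le _))//.
by rewrite mulrDl mul1r lerD2l bg'.
Qed.

Lemma dforward_tangent j s : A s -> B j (restrict_pa (dforward s) j).
Proof.
have [|_ _] := @dforward_parents_tangent j; last exact.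
by move=> i _; exact: dforward_linear_bounded.
Qed.

Lemma tangent_space_complete : hcomplete A.
Proof. exact/hclosure_complete/L2_complete. Qed.

Lemma total_adjointP j w :
  (A `*` B j) (adj j w) /\
  forall x, (A `*` B j) x -> inner (tot j x) w = inner x (adj j w).
Proof.
have [ltot ctot _] := tot_is_differential j.
apply: adjointP => //.
  exact: setX_subspace tangent_space_subspace (set_tangent_space_subspace j).
apply: setX_complete; first exact: tangent_space_complete.
by apply/hclosure_complete/dsum_complete => p; exact: hilbert_complete.
Qed.

(* Reverse accumulation preserves the derivative paired with the current
   [(f_0, ..., f_(m-1))], all other nodes having been processed. *)
Lemma backprop_inner m (f : L2 P * (forall i, W i)) : (m <= n.+1)%N -> A f.1 ->
  let f0 := (foldl (backprop_step adj) f (rev (take m (enum 'I_n.+1)))).1 in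
  A f0 /\ forall s, A s ->
    inner s f0 =
    inner s f.1 + \sum_(i < n.+1 | (i < m)%N) inner (dforward s i) (f.2 i).
Proof.
elim: m f => [|m ih] f mn Af /=.
  by rewrite take0/=; split=> // s As; rewrite big_pred0 ?addr0.
pose j := Ordinal mn.
have -> : rev (take m.+1 (enum 'I_n.+1)) = j :: rev (take m (enum 'I_n.+1)).
  rewrite (take_nth ord0) ?size_enum_ord// rev_rcons; congr cons.
  by apply: val_inj; exact: nth_enum_ord.
rewrite [foldl _ _ _]/=.
have [[Ag1 Bg2] gP] := total_adjointP j (f.2 j).
have [||Af0 f0P] := ih (backprop_step adj f j); first exact: ltnW.
  rewrite /= -[f.1]scale1r; exact: tangent_space_subspace.2.
split=> // s As; rewrite f0P// innerDr -addrA; congr (_ + _).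
have ABs : (A `*` B j) (s, restrict_pa (dforward s) j).
  by split=> //; exact: dforward_tangent.
(* The adjoint splits the term of node [j] into a pairing with [s], absorbed by [f_0], and pairings
   with the parents, all of which precede [j] and so remain in the sum. *)
have := gP _ ABs; rewrite -dforwardE => jP.
rewrite [RHS](bigD1 j)//= jP [X in _ = X + _]/inner/= -addrA; congr (_ + _).
under eq_bigr do rewrite innerDr.
rewrite big_split/= addrC; congr (_ + _).
  by apply: sum_extend_pa => i /pa_lt.
by apply: eq_bigl => i; rewrite ltnS ltn_neqAle andbC.
Qed.

(** The invariant for all [n.+1] nodes: initially only the last one carries a nonzero value, [fk],
    so a single term remains. *)
Lemma backprop_dforward (fk : W ord_max) :
  A (backprop adj fk) /\
  forall s, A s -> inner (dforward s ord_max) fk = inner s (backprop adj fk).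
Proof.
pose z : forall i, W i := fun=> 0.
have [|Af0 f0P] := @backprop_inner n.+1 (0, dfwith z ord_max fk) (leqnn _).
  exact: tangent_space_subspace.1.
rewrite take_oversize ?size_enum_ord// in Af0 f0P *.
split=> // s As; rewrite /backprop f0P//= [inner s 0]innerC inner0l add0r.
rewrite (bigD1 ord_max)//= dfwithin big1 ?addr0// => i /andP[_ im].
by rewrite dfwithout 1?eq_sym// innerC inner0l.
Qed.

End composition.

(** * Uniqueness of the differential, and conclusion *)

(** At a score, both candidates approximate the same increment of [nu] up to [o(e)], hence coincide;
    closure of the span does the rest, and norm 0 means equality in [W]. *)
Lemma differential_unique (R : realType) (d : measure_display)
    (Z : measurableType d) (M : set (probability Z R)) (W : hilbertType R)
    (nu : probability Z R -> W) (P : probability Z R) (D D' : L2 P -> W) :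
  is_differential M nu D -> is_differential M nu D' ->
  forall s, model_tangent_space M P s -> D s = D' s.
Proof.
move=> [lD cD dD] [lD' cD' dD'] s As.
have sA : linear_subspace (model_tangent_space M P).
  exact/hclosure_subspace/lspan_subspace.
apply/eqP; rewrite -subr_eq0 -normr_eq0 -hnorm_norm; apply/eqP.
move: s As; apply: linear_on_hclosure_unique => //.
- exact: continuous_bounded_on.
- exact: continuous_bounded_on.
move=> s [Pe sPe]; apply/eqP; rewrite -subr_eq0 -normr_eq0 -hnorm_norm.
rewrite eq_le hnorm_ge0 andbT; apply/ler_addgt0Pr => r r0; rewrite add0r.
have r20 : 0 < r / 2 by rewrite divr_gt0.
have dDr := (littleo_rightP (fun e => hnorm_ge0 _)).1 (dD s Pe sPe) _ r20.
have dD'r := (littleo_rightP (fun e => hnorm_ge0 _)).1 (dD' s Pe sPe) _ r20.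
have [e [[De D'e] e0]] :=
  @filter_ex R (0^'+) _ _ (filterI (filterI dDr dD'r) (nbhs_right_gt (0 : R))).
rewrite -(ler_pM2l e0) -{1}(gtr0_norm e0) -hnormZ.
set y := nu (Pe e) - nu P in De D'e.
have -> : e *: (D s - D' s) = (y - e *: D' s) - (y - e *: D s).
  by rewrite scalerBr opprB [RHS]addrC addrA subrK.
by rewrite (le_trans (ler_hnormB _ _))// (le_trans (lerD D'e De))//; lra.
Qed.

Theorem theorem1 (R : realType) (d : measure_display) (Z : measurableType d)
    (M : set (probability Z R))
    (n : nat) (pa : 'I_n.+1 -> {set 'I_n.+1})
    (pa_lt : forall i j : 'I_n.+1, i \in pa j -> (i < j)%N)
    (W : 'I_n.+1 -> hilbertType R)
    (V : forall j : 'I_n.+1, set (W j))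
    (U : forall j : 'I_n.+1, set (Wpa pa W j))
    (sub_prodV_U : forall (j : 'I_n.+1) (u : Wpa pa W j),
      (forall i : parent pa j, V (val i) (u i)) -> U j u)
    (theta : forall j : 'I_n.+1, probability Z R -> Wpa pa W j -> W j)
    (theta_V : forall (j : 'I_n.+1) (Q : probability Z R) (u : Wpa pa W j),
      M Q -> U j u -> V j (theta j Q u))
    (psi : probability Z R -> W ord_max)
    (psiE : forall Q : probability Z R, M Q -> forward theta Q ord_max = psi Q)
    (P : probability Z R) (MP : M P)
    (theta_diff : forall j : 'I_n.+1,
      totally_pathwise_differentiable M (U j) (theta j) P
        (restrict_pa (forward theta P) j)) :
  pathwise_differentiable M psi P /\
  forall fk : W ord_max,
    backprop (fun j : 'I_n.+1 =>
      total_differential_adjoint M (U j) (theta j) P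
        (restrict_pa (forward theta P) j)) fk
    = efficient_influence_operator M psi P fk %[ae P].
Proof.
set A := model_tangent_space M P.
have sA : linear_subspace A by exact/hclosure_subspace/lspan_subspace.
pose D s := dforward (M := M) (U := U) (theta := theta) (P := P) s ord_max.
have [lD bD] := dforward_linear_bounded pa_lt sub_prodV_U theta_V theta_diff ord_max.
have DP : is_differential M psi D.
  split=> //; first exact: bounded_continuous_on.
  move=> s Pe sPe; apply/littleo_rightP => [e|r r0]; first exact: hnorm_ge0.
  have := forward_differentiable pa_lt sub_prodV_U theta_V theta_diff
    s Pe ord_max r sPe r0.
  (* The bound [e <= 1] ensures that [Pe e] lies in [M], where [psi] is the forward evaluation. *)
  move=> /filterI /(_ (filterI (nbhs_right_gt 0) (nbhs_right_le ltr01))).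
  apply: filterS => e [+ [e0 e1]]; have [MPe _ _] := sPe.
  by rewrite psiE// ?psiE//; apply: MPe; rewrite (ltW e0).
split=> [|fk]; first by exists D.
have [lD' cD' dD'] : is_differential M psi (differential M psi (P := P)).
  by rewrite /differential; case: xgetP => [D' -> //|/(_ D)].
have [Ab bP] := backprop_dforward pa_lt sub_prodV_U theta_V theta_diff fk.
have [Aeff effP] := adjointP fk sA tangent_space_complete lD' cD'.
set b := backprop _ fk in Ab bP *.
(* Both elements lie in [A] and represent the same functional there, so their difference [x], itself
   in [A], satisfies [inner x x = 0]. *)
apply: L2_inner0_ae; set x := _ - _.
have Ax : A x by exact: (subspaceB sA Ab Aeff).
rewrite {2}/x innerBr -bP// -effP//.
have := differential_unique DP (And3 lD' cD' dD') Ax; rewrite /D => ->.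
exact: subrr.
Qed.
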